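(* Let $m\ge1$ be an integer, $0\le\gamma<1$, and let $D=\{\rho<0\}\subset\mathbb{C}^n$ be a bounded $\mathcal{C}^{m,\gamma}$-smooth domain with defining function $\rho$. For $p\in\partial D$ let $p_t:=p+t\,n_p$, where $n_p$ is the inner unit normal vector to $\partial D$ at $p$. Assume that there are a nonzero vector $v\in T_p^{\mathbb{C}}\partial D$ and $c>0$ such that $\rho(p+\lambda v)\le-c|\lambda|^{m+\gamma}$ for all $\lambda\in\mathbb{C}$ close enough to $0$. Then: (1) for $0<\delta<\varepsilon$ small enough, $\ell_D^{(2)}(p_\varepsilon,p_\delta)\lesssim(\varepsilon-\delta)\,\varepsilon^{\frac1{m+\gamma}-1}\asymp\varepsilon^{\frac1{m+\gamma}}-\delta^{\frac1{m+\gamma}}$; (2) for $\varepsilon>0$ small enough, $\kappa_D^{(2)}(p_\varepsilon;n_p)\lesssim\varepsilon^{\frac1{m+\gamma}-1}$.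
   Context: $\mathbb{D}$ is the open unit disc in $\mathbb{C}$ and $\mathcal{O}(\mathbb{D},D)$ is the set of holomorphic maps $\mathbb{D}\to D$. For $z,w\in D$, $X\in\mathbb{C}^n$: $\ell_D(z,w):=\inf\{|\alpha|:\alpha\in\mathbb{D},\ \exists\varphi\in\mathcal{O}(\mathbb{D},D),\ \varphi(0)=z,\ \varphi(\alpha)=w\}$; $\ell_D^{(2)}(z,w):=\inf_{y\in D}(\ell_D(z,y)+\ell_D(y,w))$; $\kappa_D(z;X):=\inf\{|\alpha|:\alpha\in\mathbb{C},\ \exists\varphi\in\mathcal{O}(\mathbb{D},D),\ \varphi(0)=z,\ \alpha\varphi'(0)=X\}$; $\kappa_D^{(2)}(z;X):=\inf\{\kappa_D(z;X_1)+\kappa_D(z;X_2):X_1+X_2=X\}$. $T_p^{\mathbb{C}}\partial D$ is the complex tangent space to $\partial D$ at $p$. The defining function $\rho$ is of class $\mathcal{C}^{m,\gamma}$ with nonvanishing gradient on $\partial D$. $A\lesssim B$ means $A\le CB$ for some constant $C>0$ independent of $\delta,\varepsilon$; $A\asymp B$ means $A\lesssim B$ and $B\lesssim A$. ''Small enough'' means: for all parameters below some $\varepsilon_0>0$. *)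

(* Defs.v *)
From HB Require Import structures.
From mathcomp Require Import all_boot all_order all_algebra complex.
From mathcomp Require Import all_classical all_reals all_analysis.
Import Order.TTheory GRing.Theory Num.Theory.
Import numFieldNormedType.Exports.

Set Implicit Arguments.
Unset Strict Implicit.
Unset Printing Implicit Defensive.

Local Open Scope classical_set_scope.
Local Open Scope ring_scope.
Local Open Scope complex_scope.

(* C = R[i] and C^n = 'rV[R[i]]_n.  The complex numbers
   are normed over themselves, so [derivable phi z 1] for a map phi defined on
   R[i] is complex differentiability at z. *)
HB.instance Definition _ (R : realType) := NormedModule.copy R[i] R[i]^o.

(* R-valued modulus; the norm `|z| of R[i] is (cmod z)%:C. *)
Notation cmod := Normc.normc.

(* The inner product and norm of C^n = R^(2n).  The library norm on row vectors
   is the sup norm: it gives the same topology, but not the same unit normal. *)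
Definition rdot (R : realType) (n : nat) (u v : 'rV[R[i]]_n) : R :=
  \sum_j (complex.Re (u 0 j) * complex.Re (v 0 j)
          + complex.Im (u 0 j) * complex.Im (v 0 j)).

Definition enorm (R : realType) (n : nat) (u : 'rV[R[i]]_n) : R :=
  Num.sqrt (rdot u u).

(* The 2n real coordinate directions: (j, false) is that of Re z_j and (j, true)
   that of Im z_j. *)
Definition rdir (R : realType) (n : nat) (k : 'I_n * bool) : 'rV[R[i]]_n :=
  (if k.2 then 'i else 1) *: delta_mx 0 k.1.

Definition rslice (R : realType) (n : nat) (f : 'rV[R[i]]_n -> R)
    (k : 'I_n * bool) (z : 'rV[R[i]]_n) : R -> R :=
  fun t => f (z + t%:C *: rdir R k).

Definition rpartial (R : realType) (n : nat) (k : 'I_n * bool)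
    (f : 'rV[R[i]]_n -> R) (z : 'rV[R[i]]_n) : R :=
  derive1 (rslice f k z) 0.

Definition rpartials (R : realType) (n : nat) (s : seq ('I_n * bool))
    (f : 'rV[R[i]]_n -> R) : 'rV[R[i]]_n -> R :=
  foldr (@rpartial R n) f s.

(* f is C^(m, gamma) on the open set U: its real partial derivatives up to order
   m exist and are continuous on U, and those of order m are locally
   gamma-Hoelder.  As 0 `^ 0 = 1, the last clause follows from continuity when
   gamma = 0, so that C^(m, 0) is C^m. *)
Definition Cmgamma (R : realType) (n m : nat) (gamma : R)
    (U : set 'rV[R[i]]_n) (f : 'rV[R[i]]_n -> R) : Prop :=
  [/\ forall s k z, (size s < m)%N -> U z ->
        derivable (rslice (rpartials s f) k z) 0 1,
      forall s z, (size s <= m)%N -> U z -> {for z, continuous (rpartials s f)}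
    & forall s z, size s = m -> U z ->
        exists2 C : R, 0 < C &
          exists2 V : set 'rV[R[i]]_n, nbhs z V &
            forall x y, V x -> V y ->
              `|rpartials s f x - rpartials s f y| <= C * enorm (x - y) `^ gamma].

Definition grad (R : realType) (n : nat) (rho : 'rV[R[i]]_n -> R)
    (z : 'rV[R[i]]_n) : 'rV[R[i]]_n :=
  \row_j (rpartial (j, false) rho z +i* rpartial (j, true) rho z).

Definition boundary (T : topologicalType) (D : set T) : set T :=
  closure D `\` interior D.

Definition bounded_domain (R : realType) (n : nat) (D : set 'rV[R[i]]_n) : Prop :=
  [/\ open D, D !=set0, connected D & bounded_set D].

(* D = {rho < 0}, where rho needs to be regular only near the boundary of D.
   A rho given only on a neighbourhood of the closure, or of the boundary, of D
   is covered: extend it by a negative constant inside D and by a positive one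
   outside D. *)
Definition Cmgamma_defining (R : realType) (n m : nat) (gamma : R)
    (D : set 'rV[R[i]]_n) (rho : 'rV[R[i]]_n -> R) : Prop :=
  [/\ D = [set z | rho z < 0],
      exists U, [/\ open U, boundary D `<=` U & Cmgamma m gamma U rho]
    & forall z, boundary D z -> grad rho z != 0].

Definition tangent (R : realType) (n : nat) (rho : 'rV[R[i]]_n -> R)
    (p : 'rV[R[i]]_n) : set 'rV[R[i]]_n :=
  [set v | rdot (grad rho p) v = 0].

(* T_p^C = T_p `&` i T_p *)
Definition complex_tangent (R : realType) (n : nat) (rho : 'rV[R[i]]_n -> R)
    (p : 'rV[R[i]]_n) : set 'rV[R[i]]_n :=
  [set v | tangent rho p v /\ tangent rho p ('i *: v)].

Definition inner_normal (R : realType) (n : nat) (rho : 'rV[R[i]]_n -> R)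
    (p : 'rV[R[i]]_n) : 'rV[R[i]]_n :=
  - ((enorm (grad rho p))^-1%:C *: grad rho p).

Definition normal_pt (R : realType) (n : nat) (rho : 'rV[R[i]]_n -> R)
    (p : 'rV[R[i]]_n) (t : R) : 'rV[R[i]]_n :=
  p + t%:C *: inner_normal rho p.

Definition disc (R : realType) : set R[i] := [set z | cmod z < 1].

Definition holo (R : realType) (n : nat) (D : set 'rV[R[i]]_n) :
    set (R[i] -> 'rV[R[i]]_n) :=
  [set phi | forall z, disc z -> derivable phi z 1 /\ D (phi z)].

(* The infima are taken in \bar R, where the infimum of the empty set is +oo. *)
Definition ell (R : realType) (n : nat) (D : set 'rV[R[i]]_n)
    (z w : 'rV[R[i]]_n) : \bar R :=
  ereal_inf [set (cmod a)%:E | a in [set a | disc a /\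
    exists phi, [/\ holo D phi, phi 0 = z & phi a = w]]].

Definition ell2 (R : realType) (n : nat) (D : set 'rV[R[i]]_n)
    (z w : 'rV[R[i]]_n) : \bar R :=
  ereal_inf [set (ell D z y + ell D y w)%E | y in D].

Definition kappa (R : realType) (n : nat) (D : set 'rV[R[i]]_n)
    (z X : 'rV[R[i]]_n) : \bar R :=
  ereal_inf [set (cmod a)%:E | a in [set a |
    exists phi, [/\ holo D phi, phi 0 = z & a *: derive1 phi 0 = X]]].

Definition kappa2 (R : realType) (n : nat) (D : set 'rV[R[i]]_n)
    (z X : 'rV[R[i]]_n) : \bar R :=
  ereal_inf [set (kappa D z Y.1 + kappa D z Y.2)%E |
    Y in [set Y : 'rV[R[i]]_n * 'rV[R[i]]_n | Y.1 + Y.2 = X]].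

(* Main.v *)
Require Import Defs.
From mathcomp Require Import all_boot all_order all_algebra complex.
From mathcomp Require Import all_classical all_reals all_analysis.
From mathcomp Require Import ring lra.

(** Write s = m + gamma >= 1, G for the norm of the gradient of rho at p, and nu
for the inner unit normal.  Three features of the situation carry the proof: rho is
of class C^1 near p, its gradient at p does not vanish, and rho is at most
- c |l|^s on the complex line p + l v.

Class C^1 makes rho strictly differentiable at p, so for small l and w the
increment of rho from p + l v to p + l v + w nu is - G Re w up to an error of
G |w| / 2.  Hence D contains every such point for which
    0 < c |l|^s + G (Re w - |w| / 2)                    ([flat_region]).
Two kinds of affine discs fit into this region.

- The disc z |-> p_eps + z (A v + B nu), |z| < 1, where A is a small constant and
  |B| = b eps^(1 - 1/s) ([tilted_disc_in_domain]).  Here l = z A and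
  w = eps + z B, so what has to be absorbed is |z B|, and
      eps^(1 - 1/s) t <= eps + t^s                      ([powR_mul_le_add])
  says that either the depth eps or the gain c |l|^s along v absorbs it.  The
  normal speed B of this disc is much larger than the distance eps to the
  boundary; this is where the exponent comes from.

- Discs in the complex line through p_delta in the direction v, which is flat
  at every depth delta ([complex_line_in_domain]).

Infinitesimally, A v + B nu and - A v + B nu both have Kobayashi length at most 1
at p_eps, and their sum is 2 B nu: so nu = X_1 + X_2 with both lengths at most
1 / (2 B), and kappa^(2) (p_eps; nu) <= 1 / B.

For the distance, go down the tilted disc with normal speed - B up to the
parameter a = (eps - delta) / B: the point y reached has depth exactly delta and
horizontal displacement a A v.  A disc centred at y in the complex line of
direction v brings it back to p_delta at the same parameter a.  Hence
ell^(2) (p_eps, p_delta) <= 2 a.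

The comparison of (eps - delta) eps^(1/s - 1) with eps^(1/s) - delta^(1/s) is the
concavity of x |-> x^(1/s). *)

Import Order.TTheory GRing.Theory Num.Theory.
Import numFieldNormedType.Exports.

Set Implicit Arguments.
Unset Strict Implicit.
Unset Printing Implicit Defensive.

Local Open Scope classical_set_scope.
Local Open Scope ring_scope.
Local Open Scope complex_scope.

(** * Strict differentiability of functions of class C^1 *)

(** The radii of the balls of C^n are positive elements of R[i]: they are real. *)
Lemma gt0_complexE (R : realType) (e : R[i]) : 0 < e -> e = (complex.Re e)%:C.
Proof. by rewrite ltcE => /andP[/eqP]; case: e => a b /= ->. Qed.

(** The mean value theorem along one real coordinate direction.  The increment is
parametrized by s in [0, 1] as s t, so that t may have either sign. *)
Lemma rslice_increment_le (R : realType) (n : nat) (f : 'rV[R[i]]_n -> R)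
    (k : 'I_n * bool) (x : 'rV[R[i]]_n) (t a eta : R) :
  (forall tau : R, `|tau| <= `|t| ->
     derivable (rslice f k (x + tau%:C *: rdir R k)) 0 1 /\
     `|rpartial k f (x + tau%:C *: rdir R k) - a| <= eta) ->
  `|f (x + t%:C *: rdir R k) - f x - t * a| <= eta * `|t|.
Proof.
move=> hf.
pose z s : 'rV[R[i]]_n := x + (s * t)%:C *: rdir R k.
pose h (s : R) := f (z s).
have hz (s : R) : 0 <= s <= 1 -> `|s * t| <= `|t|.
  by case/andP=> s0 s1; rewrite normrM ger0_norm // ler_piMl.
have dh (s : R) : 0 <= s <= 1 -> is_derive s 1 h (t * rpartial k f (z s)).
  move=> /hz/hf [df _].
  pose g := rslice f k (z s).
  have -> : h = g \o (fun u : R => (u - s) * t).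
    apply/funext => u; rewrite /h /g /rslice /= /z -addrA -scalerDl -rmorphD /=.
    by congr (f (_ + _%:C *: _)); ring.
  rewrite mulrC.
  apply: is_derive1_comp.
    by rewrite subrr mul0r /rpartial derive1E; apply: derivableP.
  have -> : (fun u : R => (u - s) * t) = t \*: (id - cst s).
    by apply/funext => u /=; rewrite !fctE mulrC.
  by apply: is_derive_eq; rewrite subr0 /GRing.scale /= mulr1.
have [|||s /itvP s01] := @MVT_segment R h (fun s => t * rpartial k f (z s)) 0 1.
- by [].
- by move=> s /itvP s01; apply: dh; rewrite !s01.
- apply: derivable_within_continuous => s /itvP s01.
  by apply: ex_derive; apply: dh; rewrite !s01.
rewrite /h /z mul0r mul1r scale0r addr0 subr0 mulr1 => ->.
rewrite -mulrBr normrM mulrC ler_wpM2r //.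
by apply: (hf _ _).2; apply: hz; rewrite !s01.
Qed.

Lemma normr_rdir (R : realType) (n : nat) (k : 'I_n * bool) :
  `|rdir R k| <= 1.
Proof.
rewrite /rdir normrZ.
have -> : `|(if k.2 then 'i else 1) : R[i]| = 1.
  by case: k.2; rewrite ?normr1 // normc_def /= expr0n expr1n add0r sqrtr1.
rewrite mul1r -[leLHS]/(mx_norm _).
have [->|/mx_norm_neq0[ij ->]] := eqVneq (mx_norm (delta_mx 0 k.1 : 'rV[R[i]]_n)) 0 => //.
by rewrite mxE; case: eqP; case: eqP; rewrite ?normr1 ?normr0.
Qed.

(** From x to x + sum_k t_k e_k one walks parallel to the coordinate axes.  Since
the e_k have norm at most 1, bounding |x - p| + sum_k |t_k| by r keeps every
corner and every edge of the walk in the ball where f is controlled. *)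
Lemma path_increment_le (R : realType) (n : nat) (f : 'rV[R[i]]_n -> R)
    (p : 'rV[R[i]]_n) (r eta : R) (a t : 'I_n * bool -> R) :
  (forall k z, `|z - p| < r%:C ->
     derivable (rslice f k z) 0 1 /\ `|rpartial k f z - a k| <= eta) ->
  forall (s : seq ('I_n * bool)) x, `|x - p| + (\sum_(k <- s) `|t k|)%:C < r%:C ->
  `|f (x + \sum_(k <- s) (t k)%:C *: rdir R k) - f x - \sum_(k <- s) t k * a k|
    <= eta * \sum_(k <- s) `|t k|.
Proof.
move=> hf; elim=> [|k s IH] x.
  by rewrite !big_nil !addr0 subr0 subrr normr0 mulr0.
rewrite !big_cons => hx.
have step (tau : R) : `|tau| <= `|t k| ->
    `|x + tau%:C *: rdir R k - p| <= `|x - p| + `|t k|%:C.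
  move=> htau; rewrite addrAC; apply: (le_trans (ler_normD _ _)); rewrite lerD2l normrZ.
  apply: (@le_trans _ _ (`|tau%:C| * 1)); first by rewrite ler_wpM2l // normr_rdir.
  by rewrite mulr1 normc_def /= expr0n addr0 sqrtr_sqr lecR.
have h1 : `|f (x + (t k)%:C *: rdir R k) - f x - t k * a k| <= eta * `|t k|.
  apply: rslice_increment_le => tau htau; apply: hf.
  apply: le_lt_trans (step _ htau) (le_lt_trans _ hx).
  by rewrite lerD2l lecR lerDl sumr_ge0.
have h2 := IH (x + (t k)%:C *: rdir R k).
rewrite addrA.
have -> : f (x + (t k)%:C *: rdir R k + \sum_(j <- s) (t j)%:C *: rdir R j) - f x -
  (t k * a k + \sum_(j <- s) t j * a j) =
  (f (x + (t k)%:C *: rdir R k + \sum_(j <- s) (t j)%:C *: rdir R j) -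
   f (x + (t k)%:C *: rdir R k) - \sum_(j <- s) t j * a j) +
  (f (x + (t k)%:C *: rdir R k) - f x - t k * a k) by ring.
rewrite mulrDr addrC; apply: le_trans (ler_normD _ _) _.
rewrite [leLHS]addrC [leRHS]addrC; apply: lerD; last by [].
apply: h2; apply: le_lt_trans hx.
by rewrite rmorphD /= addrA lerD2r step.
Qed.

Definition rcoord (R : realType) (n : nat) (u : 'rV[R[i]]_n) (k : 'I_n * bool) : R :=
  if k.2 then complex.Im (u 0 k.1) else complex.Re (u 0 k.1).

Lemma sum_rcoord (R : realType) (n : nat) (u : 'rV[R[i]]_n) :
  \sum_k (rcoord u k)%:C *: rdir R k = u.
Proof.
apply/rowP => j; rewrite summxE.
rewrite -(pair_bigA _ (fun j' b => ((rcoord u (j', b))%:C *: rdir R (j', b)) 0 j)) /=.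
rewrite (bigD1 j) //= [X in _ + X]big1 ?addr0 => [|j' jj'].
  rewrite big_bool /rcoord /rdir /= !mxE !eqxx mul1r.
  by case: (u 0 j) => x y; simpc.
by rewrite big_bool /rdir /= !mxE eq_sym (negPf jj') andbF !mulr0 addr0.
Qed.

Lemma rdot_grad (R : realType) (n : nat) (f : 'rV[R[i]]_n -> R) (p u : 'rV[R[i]]_n) :
  rdot (grad f p) u = \sum_k rcoord u k * rpartial k f p.
Proof.
rewrite -(pair_bigA _ (fun j b => rcoord u (j, b) * rpartial (j, b) f p)) /=.
apply: eq_bigr => j _; rewrite big_bool /rcoord /grad !mxE /= addrC.
by congr (_ + _); exact: mulrC.
Qed.

Lemma rdotZ (R : realType) (n : nat) (u : 'rV[R[i]]_n) (w : R[i]) :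
  rdot u (w *: u) = complex.Re w * rdot u u.
Proof.
rewrite /rdot mulr_sumr; apply: eq_bigr => j _; rewrite mxE.
by case: w (u 0 j) => [a b] [c d] /=; ring.
Qed.

Lemma rdot_ge0 (R : realType) (n : nat) (u : 'rV[R[i]]_n) : 0 <= rdot u u.
Proof. by apply: sumr_ge0 => j _; rewrite -!expr2 addr_ge0 ?sqr_ge0. Qed.

Lemma enormZ (R : realType) (n : nat) (u : 'rV[R[i]]_n) (w : R[i]) :
  enorm (w *: u) = cmod w * enorm u.
Proof.
rewrite /enorm.
have -> : rdot (w *: u) (w *: u) = (complex.Re w ^+ 2 + complex.Im w ^+ 2) * rdot u u.
  rewrite /rdot mulr_sumr; apply: eq_bigr => j _; rewrite mxE.
  by case: w (u 0 j) => [a b] [c d] /=; ring.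
by rewrite sqrtrM ?addr_ge0 ?sqr_ge0 //; case: w.
Qed.

Lemma rcoord_le_enorm (R : realType) (n : nat) (u : 'rV[R[i]]_n) (k : 'I_n * bool) :
  `|rcoord u k| <= enorm u.
Proof.
rewrite -sqrtr_sqr ler_wsqrtr // /rdot (bigD1 k.1) //= -!expr2 /rcoord.
apply: ler_wpDr; first by apply: sumr_ge0 => j _; rewrite -!expr2 addr_ge0 ?sqr_ge0.
by case: k.2; rewrite ?lerDl ?lerDr sqr_ge0.
Qed.

Lemma enorm_gt0 (R : realType) (n : nat) (u : 'rV[R[i]]_n) : u != 0 -> 0 < enorm u.
Proof.
move=> u0; rewrite lt_neqAle sqrtr_ge0 andbT; apply: contra_neq u0 => u0.
rewrite -[u]sum_rcoord big1 // => k _.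
have := rcoord_le_enorm u k; rewrite -u0 normr_le0 => /eqP ->.
by rewrite scale0r.
Qed.

Lemma Cmgamma_partials_near (R : realType) (n m : nat) (gamma eta : R)
    (U : set 'rV[R[i]]_n) (f : 'rV[R[i]]_n -> R) (p : 'rV[R[i]]_n) :
  (1 <= m)%N -> open U -> U p -> Cmgamma m gamma U f -> 0 < eta ->
  exists2 r : R, 0 < r & forall k z, `|z - p| < r%:C ->
    derivable (rslice f k z) 0 1 /\ `|rpartial k f z - rpartial k f p| <= eta.
Proof.
move=> m1 oU Up [df cf _] eta0.
have near1 (k : 'I_n * bool) : \forall z \near p,
    derivable (rslice f k z) 0 1 /\ `|rpartial k f z - rpartial k f p| <= eta.
  have := cf [:: k] p m1 Up => /cvgrPdist_le/(_ _ eta0) ck.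
  near=> z; split; last by rewrite distrC; near: z.
  by apply: (df [::] k z m1); near: z; exact: open_nbhs_nbhs.
have /nbhs_normP[e /= e0 he] :=
  @filter_forall _ ('I_n * bool)%type _ _ (nbhs_filter p) near1.
have eE := gt0_complexE e0.
exists (complex.Re e) => [|k z zp]; first by rewrite -ltcR -eE.
by apply: he; rewrite /ball_ /= distrC eE.
Unshelve. all: by end_near. Qed.

(** Both end points x and x + u vary, which is what makes differentiability at p
strict: the base point x is going to run through the complex line p + l v.  The
coordinates of u sum up to at most 2 n |u|, hence the tolerance eta / N for the
partial derivatives. *)
Lemma Cmgamma_strictly_differentiable (R : realType) (n m : nat) (gamma eta : R)
    (U : set 'rV[R[i]]_n) (f : 'rV[R[i]]_n -> R) (p : 'rV[R[i]]_n) :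
  (1 <= m)%N -> open U -> U p -> Cmgamma m gamma U f -> 0 < eta ->
  exists2 r : R, 0 < r & forall x u, `|x - p| < r%:C -> enorm u < r ->
    `|f (x + u) - f x - rdot (grad f p) u| <= eta * enorm u.
Proof.
move=> m1 oU Up Cf eta0.
pose N : R := (#|{: 'I_n * bool}|)%:R + 1.
have N0 : 0 < N by rewrite ltr_wpDl.
have [r r0 hr] := Cmgamma_partials_near m1 oU Up Cf (divr_gt0 eta0 N0).
have N1 : 1 <= N by rewrite lerDr.
have rN : 0 < r / 2 / N by rewrite !divr_gt0.
exists (r / 2 / N) => // x u xp ur.
have Su : \sum_k `|rcoord u k| <= N * enorm u.
  apply: le_trans (_ : \sum_(k : 'I_n * bool) enorm u <= _).
    by apply: ler_sum => k _; exact: rcoord_le_enorm.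
  by rewrite sumr_const -mulr_natl ler_wpM2r ?sqrtr_ge0 // lerDl.
have := @path_increment_le R n f p r (eta / N) (fun k => rpartial k f p) (rcoord u) hr
  (index_enum _) x.
rewrite sum_rcoord -rdot_grad => h.
apply: le_trans (h _) _.
  apply: (@lt_le_trans _ _ ((r / 2 / N)%:C + (r / 2)%:C)).
    apply: ltr_leD => //; rewrite lecR (le_trans Su) //.
    by rewrite mulrC -ler_pdivlMr // ltW.
  rewrite -rmorphD lecR.
  have : r / 2 / N <= r / 2 by rewrite ler_pdivrMr // ler_peMr // divr_ge0 // ltW.
  by lra.
by rewrite mulrAC ler_pdivrMr // -mulrA ler_wpM2l ?(ltW eta0) // mulrC.
Qed.

(** * Inequalities between powers *)

(** Concavity at 1.  With y = theta ln x, it is the combination, with weights theta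
and 1 - theta, of the tangent inequality of the exponential at y, evaluated at
ln x and at 0. *)
Lemma powR_tangent_le (R : realType) (x theta : R) :
  0 < x -> 0 <= theta <= 1 -> x `^ theta <= 1 + theta * (x - 1).
Proof.
move=> x0 /andP[t0 t1]; pose y := theta * ln x.
have xE : x = expR y * expR (ln x - y) by rewrite -expRD addrC subrK lnK.
have oneE : 1 = expR y * expR (- y) by rewrite -expRD subrr expR0.
rewrite /powR gt_eqF // -/y.
have h1 : expR y * (1 + (ln x - y)) <= x by rewrite {2}xE ler_pM2l ?expR_gt0 ?expR_ge1Dx.
have h2 : expR y * (1 + - y) <= 1 by rewrite [leRHS]oneE ler_pM2l ?expR_gt0 ?expR_ge1Dx.
have h1' := ler_wpM2l t0 h1.
have h2' : (1 - theta) * (expR y * (1 + - y)) <= (1 - theta) * 1.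
  by rewrite ler_wpM2l // subr_ge0.
have : theta * (expR y * (1 + (ln x - y))) + (1 - theta) * (expR y * (1 + - y)) = expR y.
  by rewrite /y; ring.
by lra.
Qed.

Lemma powR_diff_ge (R : realType) (eps delta theta : R) :
  0 < delta -> delta < eps -> 0 <= theta <= 1 ->
  theta * ((eps - delta) * eps `^ (theta - 1)) <= eps `^ theta - delta `^ theta.
Proof.
move=> d0 de t01; have e0 := lt_trans d0 de.
have /powR_tangent_le/(_ t01) h : 0 < delta / eps by rewrite divr_gt0.
have E : eps `^ theta = eps * eps `^ (theta - 1).
  by rewrite -{2}(powRr1 (ltW e0)) -powRD ?(gt_eqF e0) ?implybT // addrC subrK.
have D : delta `^ theta = (delta / eps) `^ theta * eps `^ theta.
  by rewrite -powRM ?divr_ge0 ?ltW // divfK // gt_eqF.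
have := ler_wpM2r (powR_ge0 eps theta) h; rewrite -D E.
set q := eps `^ (theta - 1).
have -> : (1 + theta * (delta / eps - 1)) * (eps * q) =
   eps * q - theta * ((eps - delta) * q) by field; rewrite gt_eqF.
by lra.
Qed.

Lemma powR_diff_le (R : realType) (eps delta theta : R) :
  0 < delta -> delta < eps -> theta <= 1 ->
  eps `^ theta - delta `^ theta <= (eps - delta) * eps `^ (theta - 1).
Proof.
move=> d0 de t1; have e0 := lt_trans d0 de.
have E x : 0 < x -> x `^ theta = x * x `^ (theta - 1).
  by move=> x0; rewrite -{2}(powRr1 (ltW x0)) -powRD ?(gt_eqF x0) ?implybT // addrC subrK.
rewrite (E eps) // (E delta) // mulrBl lerD2l lerN2 ler_pM2l //.
rewrite -opprB !powRN lef_pV2 ?posrE ?powR_gt0 //.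
by apply: ge0_ler_powR; rewrite ?nnegrE ?subr_ge0 // ltW.
Qed.

(** The larger of t and eps^(1/s) decides: the product is at most eps when
t <= eps^(1/s), and at most t^(s - 1) t otherwise. *)
Lemma powR_mul_le_add (R : realType) (eps t s : R) :
  0 < eps -> 0 <= t -> 1 <= s -> eps `^ (1 - s^-1) * t <= eps + t `^ s.
Proof.
move=> e0 t0 s1; have s0 : 0 < s by apply: lt_le_trans s1.
have [tle|/ltW tge] := leP t (eps `^ s^-1).
  apply: ler_wpDr; first exact: powR_ge0.
  apply: le_trans (ler_wpM2l (powR_ge0 _ _) tle) _.
  by rewrite -powRD ?(gt_eqF e0) ?implybT // subrK powRr1 // ltW.
apply: ler_wpDl; first exact: ltW.
rewrite -(mulr_powRB1 t0 s0) mulrC ler_wpM2l //.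
have -> : 1 - s^-1 = s^-1 * (s - 1) by field; rewrite gt_eqF.
by rewrite powRrM; apply: ge0_ler_powR; rewrite ?nnegrE ?powR_ge0 ?subr_ge0.
Qed.

(** * Affine discs *)

Lemma cmod_real (R : realType) (t : R) : cmod t%:C = `|t|.
Proof. by rewrite /= expr0n addr0 sqrtr_sqr. Qed.

Lemma cmod_ge0 (R : realType) (z : R[i]) : 0 <= cmod z.
Proof. by case: z => a b; exact: sqrtr_ge0. Qed.

Lemma cmodD_le (R : realType) (x y : R[i]) : cmod (x + y) <= cmod x + cmod y.
Proof. by rewrite -lecR rmorphD; exact: (ler_normD x y). Qed.

Lemma Re_ge_Ncmod (R : realType) (z : R[i]) : - cmod z <= complex.Re z.
Proof.
apply: (@le_trans _ _ (- `|complex.Re z|)); last by rewrite lerNl -normrN ler_norm.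
by rewrite lerN2 -lecR; exact: normc_ge_Re.
Qed.

Lemma is_derive_affine (R : realType) (n : nat) (x u : 'rV[R[i]]_n) (z : R[i]) :
  is_derive z 1 (fun z : R[i] => x + z *: u) u.
Proof.
have q : (fun h : R[i] => h^-1 *: (((fun z : R[i] => x + z *: u) \o shift z) (h *: 1)
    - (x + z *: u))) @ 0^' --> u.
  apply: cvg_near_cst; near=> h.
  rewrite /= opprD addrACA subrr add0r scalerDl addrK scalerA.
  rewrite [h *: 1]mulr1 mulVf ?scale1r //.
  by near: h; exact: nbhs_dnbhs_neq.
by apply: DeriveDef; [apply/cvg_ex; exists u | exact: cvg_lim q].
Unshelve. all: by end_near. Qed.

Lemma holo_affine (R : realType) (n : nat) (D : set 'rV[R[i]]_n) (x u : 'rV[R[i]]_n) :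
  (forall z, disc z -> D (x + z *: u)) -> holo D (fun z => x + z *: u).
Proof.
by move=> hD z /hD ?; split=> //; apply: ex_derive; exact: is_derive_affine.
Qed.

Lemma ell_affine_le (R : realType) (n : nat) (D : set 'rV[R[i]]_n)
    (x u : 'rV[R[i]]_n) (a : R) :
  (forall z, disc z -> D (x + z *: u)) -> 0 <= a < 1 ->
  (ell D x (x + a%:C *: u)%R <= a%:E)%E.
Proof.
move=> hD /andP[a0 a1]; apply: ereal_inf_lbound; exists a%:C; last by rewrite cmod_real ger0_norm.
split; first by apply: le_lt_trans a1; rewrite cmod_real ger0_norm.
by exists (fun z => x + z *: u); split => //; [exact: holo_affine | rewrite scale0r addr0].
Qed.

Lemma kappa_affine_le (R : realType) (n : nat) (D : set 'rV[R[i]]_n)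
    (x u : 'rV[R[i]]_n) (t : R) :
  (forall z, disc z -> D (x + z *: u)) -> 0 <= t ->
  (kappa D x (t%:C *: u)%R <= t%:E)%E.
Proof.
move=> hD t0; apply: ereal_inf_lbound; exists t%:C; last by rewrite cmod_real ger0_norm.
exists (fun z => x + z *: u); split; [exact: holo_affine | by rewrite scale0r addr0 |].
by rewrite derive1E; have /@derive_val -> := is_derive_affine x u 0.
Qed.

(** * The domain near a flat complex direction *)

(** The differential of rho at p sends w nu to - G Re w, and w nu has length |w|;
strict differentiability is used with tolerance G / 2. *)
Lemma normal_variation_le (R : realType) (n m : nat) (gamma : R)
    (D : set 'rV[R[i]]_n) (rho : 'rV[R[i]]_n -> R) (p v : 'rV[R[i]]_n) :
  (1 <= m)%N -> Cmgamma_defining m gamma D rho -> boundary D p ->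
  exists2 r : R, 0 < r & forall l w : R[i],
    `|l *: v| < r%:C -> cmod w < r ->
    rho (p + l *: v + w *: inner_normal rho p) <=
      rho (p + l *: v) - enorm (grad rho p) * (complex.Re w - cmod w / 2).
Proof.
move=> m1 [_ [U [oU bU CU]] gnz] bp.
set g := grad rho p; set G := enorm g.
have G0 : 0 < G by apply: enorm_gt0; exact: gnz.
have [r r0 hr] := Cmgamma_strictly_differentiable m1 oU (bU _ bp) CU (divr_gt0 G0 (ltr0Sn R 1)).
exists r => // l w lr wr.
have nE : w *: inner_normal rho p = (w * (- G^-1)%:C) *: g.
  by rewrite /inner_normal -/g -/G rmorphN mulrN scaleNr scalerN scalerA.
have normE : enorm (w *: inner_normal rho p) = cmod w.
  rewrite nE enormZ Normc.normcM cmod_real normrN gtr0_norm ?invr_gt0 //.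
  by rewrite -mulrA mulVf ?mulr1 // gt_eqF.
have dotE : rdot g (w *: inner_normal rho p) = - (G * complex.Re w).
  rewrite nE rdotZ.
  have -> : rdot g g = G * G by rewrite -expr2 sqr_sqrtr // rdot_ge0.
  have -> : complex.Re (w * (- G^-1)%:C) = - (complex.Re w / G).
    by case: (w) => a b /=; rewrite mulr0 subr0 mulrN.
  by field; rewrite gt_eqF.
have := hr (p + l *: v) (w *: inner_normal rho p).
rewrite addrAC subrr add0r normE dotE => /(_ lr wr) /(le_trans (ler_norm _)).
by lra.
Qed.

(** All that is retained of D near p: - c |l|^s comes from the flatness of rho
along v, G Re w from its growth in the normal direction, and |w| / 2 is the
error allowed by strict differentiability. *)
Definition flat_region (R : realType) (n : nat) (D : set 'rV[R[i]]_n)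
    (p v nu : 'rV[R[i]]_n) (c s G r : R) : Prop :=
  forall l w : R[i], cmod l < r -> cmod w < r ->
    0 < c * cmod l `^ s + G * (complex.Re w - cmod w / 2) ->
    D (p + l *: v + w *: nu).

Lemma flat_region_in_domain (R : realType) (n m : nat) (gamma : R)
    (D : set 'rV[R[i]]_n) (rho : 'rV[R[i]]_n -> R) (p v : 'rV[R[i]]_n) (c s : R) :
  (1 <= m)%N -> Cmgamma_defining m gamma D rho -> boundary D p ->
  (\forall l \near (0 : R[i]), rho (p + l *: v) <= - c * cmod l `^ s) ->
  exists2 r : R, 0 < r &
    flat_region D p v (inner_normal rho p) c s (enorm (grad rho p)) r.
Proof.
move=> m1 hrho bp hflat.
have [r r0 hr] := normal_variation_le v m1 hrho bp.
have small : \forall l \near (0 : R[i]), `|l *: v| < r%:C.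
  have : l *: v @[l --> (0 : R[i])] --> (0 : 'rV[R[i]]_n).
    by rewrite -[X in _ --> X](scale0r v); exact: scalel_continuous.
  by move/cvgr0_norm_lt; apply; rewrite ltcR.
have /nbhs_normP[e /= e0 he] : \forall l \near (0 : R[i]),
    rho (p + l *: v) <= - c * cmod l `^ s /\ `|l *: v| < r%:C.
  by near=> l; split; near: l.
have eE := gt0_complexE e0.
have Re0 : 0 < complex.Re e by rewrite -ltcR -eE.
exists (Num.min r (complex.Re e)) => [|l w]; first by rewrite lt_min r0.
rewrite !lt_min => /andP[_ le] /andP[wr _] pos.
have [fl lr] : rho (p + l *: v) <= - c * cmod l `^ s /\ `|l *: v| < r%:C.
  by apply: he; rewrite /ball_ /= sub0r normrN eE ltcR.
case: hrho => -> _ _ /=.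
by have := hr l w lr wr; lra.
Unshelve. all: by end_near. Qed.

(** The constant b depends only on the region, and a single bound on |A| and |B|
covers the signs of both: the two discs used for kappa^(2) differ by the sign of
A, and the one used for ell^(2) has B < 0. *)
Lemma tilted_disc_in_domain (R : realType) (n : nat) (D : set 'rV[R[i]]_n)
    (p v nu : 'rV[R[i]]_n) (c s G r : R) :
  0 < c -> 1 <= s -> 0 < G -> 0 < r -> flat_region D p v nu c s G r ->
  exists2 b : R, 0 < b & forall (eps A B : R) (z : R[i]),
    0 < eps -> eps < Num.min 1 (r / 2) ->
    `|A| = r / 4 -> `|B| = b * eps `^ (1 - s^-1) -> disc z ->
    D (p + eps%:C *: nu + z *: (A%:C *: v + B%:C *: nu)).
Proof.
move=> c0 s1 G0 r0 region.
have s0 : 0 < s by apply: lt_le_trans s1.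
have rq0 : 0 < r / 4 by rewrite divr_gt0.
pose q := c * (r / 4) `^ s; have q0 : 0 < q by rewrite mulr_gt0 ?powR_gt0.
(* 4^-1 pays |z B| with the depth eps, r / 4 keeps w in the ball of radius r, and
   q / (2 * G) pays |z B| with the gain c |l|^s = q |z|^s. *)
pose b := Num.min (4^-1) (Num.min (r / 4) (q / (2 * G))).
have b0 : 0 < b by rewrite !lt_min invr_gt0 ltr0n rq0 /= divr_gt0 // mulr_gt0.
have [b1 b2 b3] : [/\ b <= 4^-1, b <= r / 4 & b * (2 * G) <= q].
  by rewrite -ler_pdivlMr ?mulr_gt0 // !ge_min !lexx ?orbT.
exists b => // eps A B z e0; rewrite lt_min => /andP[e1 er] hA hB hz.
have zd : cmod z < 1 := hz.
have z0 := cmod_ge0 z.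
have -> : p + eps%:C *: nu + z *: (A%:C *: v + B%:C *: nu) =
    p + (z * A%:C) *: v + (eps%:C + z * B%:C) *: nu.
  by rewrite scalerDr scalerDl !scalerA -!addrA; congr (_ + _); rewrite addrCA.
have cl : cmod (z * A%:C) = cmod z * (r / 4) by rewrite Normc.normcM cmod_real hA.
have cB : cmod (z * B%:C) = b * (eps `^ (1 - s^-1) * cmod z).
  by rewrite Normc.normcM cmod_real hB; ring.
have key := powR_mul_le_add e0 z0 s1.
have cw : cmod (eps%:C + z * B%:C) <= eps + b * (eps `^ (1 - s^-1) * cmod z).
  by rewrite -cB; apply: le_trans (cmodD_le _ _) _; rewrite cmod_real gtr0_norm.
have Rw : eps - b * (eps `^ (1 - s^-1) * cmod z) <= complex.Re (eps%:C + z * B%:C).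
  by rewrite raddfD /= lerD2l -cB; exact: Re_ge_Ncmod.
have eps1 : eps `^ (1 - s^-1) * cmod z <= 1.
  rewrite mulr_ile1 ?powR_ge0 // ?(ltW zd) //.
  apply: (@le_trans _ _ (1 `^ (1 - s^-1))); last by rewrite powR1.
  apply: ge0_ler_powR; rewrite ?nnegrE ?(ltW e0) ?(ltW e1) //.
  by rewrite subr_ge0 invf_le1.
have t0 : 0 <= eps `^ (1 - s^-1) * cmod z by rewrite mulr_ge0 ?powR_ge0.
apply: region.
- by rewrite cl; nra.
- by apply: le_lt_trans cw _; nra.
- rewrite cl powRM ?(ltW rq0) //.
  set t := eps `^ _ * _ in key cw Rw eps1 t0.
  set ts := cmod z `^ s in key *.
  have ts0 : 0 <= ts by exact: powR_ge0.
  have -> : c * (ts * (r / 4) `^ s) = q * ts by rewrite /q; ring.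
  apply: (@lt_le_trans _ _ (q * ts + G * (eps / 2 - 3 / 2 * (b * t)))); last first.
    by rewrite lerD2l ler_pM2l //; lra.
  have h1 : b * t <= b * (eps + ts) by rewrite ler_pM2l.
  have h2 : G * (b * t) <= G * (b * (eps + ts)) by rewrite ler_pM2l.
  have h3 : b * (2 * G) * ts <= q * ts by rewrite ler_wpM2r.
  have h4 : G * eps * b <= G * eps * 4^-1 by rewrite ler_pM2l // mulr_gt0.
  have h5 : 0 < G * eps by rewrite mulr_gt0.
  have h6 : 0 <= G * b * ts by rewrite !mulr_ge0 // ltW.
  by lra.
Qed.

Lemma complex_line_in_domain (R : realType) (n : nat) (D : set 'rV[R[i]]_n)
    (p v nu : 'rV[R[i]]_n) (c s G r delta : R) (l : R[i]) :
  0 < c -> 0 < G -> flat_region D p v nu c s G r ->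
  0 < delta -> delta < r -> cmod l < r -> D (p + delta%:C *: nu + l *: v).
Proof.
move=> c0 G0 region d0 dr lr; rewrite addrAC; apply: region => //; rewrite cmod_real gtr0_norm //=.
apply: ltr_wpDl; first by rewrite mulr_ge0 ?powR_ge0 // ltW.
by rewrite mulr_gt0 //; lra.
Qed.

(** * The two estimates *)

(** The first disc ends at depth eps - a B, and subtracting the horizontal part
of its displacement leads back to the normal line. *)
Lemma two_disc_chain (R : realType) (n : nat) (p v nu : 'rV[R[i]]_n)
    (eps a A B : R) (z : R[i]) :
  p + eps%:C *: nu + a%:C *: (A%:C *: v + (- B)%:C *: nu) + z *: (- (A%:C *: v)) =
    p + (eps - a * B)%:C *: nu + ((a%:C - z) * A%:C) *: v.
Proof.
by rewrite rmorphB rmorphM rmorphN; apply/rowP => j; rewrite !mxE; ring.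
Qed.

Lemma ell2_normal_le (R : realType) (n : nat) (D : set 'rV[R[i]]_n)
    (p v nu : 'rV[R[i]]_n) (c s G r : R) :
  0 < c -> 1 <= s -> 0 < G -> 0 < r -> flat_region D p v nu c s G r ->
  exists e0 C : R, [/\ 0 < e0, 0 < C &
    forall delta eps : R, 0 < delta -> delta < eps -> eps < e0 ->
      (ell2 D (p + eps%:C *: nu)%R (p + delta%:C *: nu)%R
        <= (C * ((eps - delta) * eps `^ (s^-1 - 1)))%:E)%E].
Proof.
move=> c0 s1 G0 r0 region; have s0 : 0 < s by apply: lt_le_trans s1.
have [b b0 tilted] := tilted_disc_in_domain c0 s1 G0 r0 region.
have rabs : `|r / 4| = r / 4 by rewrite ger0_norm // divr_ge0 // ltW.
(* eps < b^s makes the parameter a of the common point y smaller than 1. *)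
exists (Num.min (b `^ s) (Num.min 1 (r / 2))), (2 / b).
split; [by rewrite !lt_min powR_gt0 //= ltr01 divr_gt0 | by rewrite divr_gt0 |].
move=> delta eps d0 de; rewrite lt_min => /andP[eb esmall].
have e0 := lt_trans d0 de.
have er : eps < r / 2 by move: esmall; rewrite lt_min => /andP[].
set K := (eps - delta) * _.
have K0 : 0 <= K by rewrite mulr_ge0 ?powR_ge0 // subr_ge0 ltW.
pose B := b * eps `^ (1 - s^-1); pose a := (eps - delta) / B.
have B0 : 0 < B by rewrite mulr_gt0 ?powR_gt0.
have aK : a = K / b.
  rewrite /a /K /B -[s^-1 - 1]opprB powRN; field.
  by rewrite !gt_eqF ?powR_gt0.
have aB : a * B = eps - delta by rewrite divfK // gt_eqF.
have a01 : 0 <= a < 1.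
  rewrite aK divr_ge0 // ?ltW //= ltr_pdivrMr // mul1r.
  apply: (@le_lt_trans _ _ (eps * eps `^ (s^-1 - 1))).
    by rewrite ler_wpM2r ?powR_ge0 // gerBl ltW.
  rewrite mulr_powRB1 ?invr_gt0 ?(ltW e0) //.
  rewrite -[ltRHS](powRr1 (ltW b0)) -(mulfV (lt0r_neq0 s0)) powRrM.
  by apply: gt0_ltr_powR; rewrite ?invr_gt0 ?nnegrE ?powR_ge0 // ltW.
pose X := (r / 4)%:C *: v + (- B)%:C *: nu.
pose y := p + eps%:C *: nu + a%:C *: X.
have disc1 z : disc z -> D (p + eps%:C *: nu + z *: X).
  by apply: tilted => //; rewrite normrN gtr0_norm.
have yE z : y + z *: (- ((r / 4)%:C *: v)) =
    p + delta%:C *: nu + ((a%:C - z) * (r / 4)%:C) *: v.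
  have -> : delta = eps - a * B by rewrite aB; ring.
  exact: two_disc_chain.
have disc2 z : disc z -> D (y + z *: (- ((r / 4)%:C *: v))).
  move=> zd; rewrite yE; apply: complex_line_in_domain c0 G0 region d0 _ _; first by lra.
  have zd' : cmod z < 1 := zd.
  rewrite Normc.normcM [cmod (r / 4)%:C]cmod_real rabs.
  have := cmodD_le a%:C (- z).
  have -> : cmod (- z) = cmod z by case: (z) => x1 x2 /=; rewrite !sqrrN.
  rewrite cmod_real ger0_norm; last by case/andP: a01.
  by case/andP: a01 => a0 a1; nra.
have Dy : D y.
  by apply: disc1; case/andP: a01 => a0; apply: le_lt_trans; rewrite cmod_real ger0_norm.
have ell_1 := ell_affine_le disc1 a01.
have ell_2 := ell_affine_le disc2 a01.
rewrite yE subrr mul0r scale0r addr0 in ell_2.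
apply: (@le_trans _ _ (a%:E + a%:E)%E).
  apply: le_trans (leeD ell_1 ell_2).
  by apply: ereal_inf_lbound; exists y.
by rewrite -EFinD lee_fin aK; lra.
Qed.

Lemma kappa2_normal_le (R : realType) (n : nat) (D : set 'rV[R[i]]_n)
    (p v nu : 'rV[R[i]]_n) (c s G r : R) :
  0 < c -> 1 <= s -> 0 < G -> 0 < r -> flat_region D p v nu c s G r ->
  exists e0 C : R, [/\ 0 < e0, 0 < C &
    forall eps : R, 0 < eps -> eps < e0 ->
      (kappa2 D (p + eps%:C *: nu)%R nu <= (C * eps `^ (s^-1 - 1))%:E)%E].
Proof.
move=> c0 s1 G0 r0 region.
have [b b0 tilted] := tilted_disc_in_domain c0 s1 G0 r0 region.
have rabs : `|r / 4| = r / 4 by rewrite ger0_norm // divr_ge0 // ltW.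
exists (Num.min 1 (r / 2)), b^-1.
split; [by rewrite lt_min ltr01 divr_gt0 | by rewrite invr_gt0 |] => eps e0 esmall.
pose B := b * eps `^ (1 - s^-1).
have B0 : 0 < B by rewrite mulr_gt0 ?powR_gt0.
pose X (A : R) := A%:C *: v + B%:C *: nu.
pose t := (2 * B)^-1.
have t0 : 0 <= t by rewrite invr_ge0 mulr_ge0 // ltW.
have kX A : `|A| = r / 4 -> (kappa D (p + eps%:C *: nu)%R (t%:C *: X A)%R <= t%:E)%E.
  by move=> hA; apply: kappa_affine_le => // z; apply: tilted => //; rewrite gtr0_norm.
apply: (@le_trans _ _ (t%:E + t%:E)%E).
  apply: le_trans (leeD (kX (r / 4) rabs) (kX (- (r / 4)) _)); last by rewrite normrN.
  apply: ereal_inf_lbound; exists (t%:C *: X (r / 4), t%:C *: X (- (r / 4))) => //=.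
  rewrite -scalerDr /X rmorphN scaleNr addrACA subrr add0r -scalerDl scalerA.
  rewrite -rmorphD -rmorphM.
  have -> : t * (B + B) = 1 by rewrite /t; field; rewrite gt_eqF.
  by rewrite scale1r.
have P0 : 0 < eps `^ (1 - s^-1) by rewrite powR_gt0.
rewrite -EFinD lee_fin -[s^-1 - 1]opprB powRN /t /B.
rewrite le_eqVlt; apply/orP; left; apply/eqP; field.
by rewrite !gt_eqF.
Qed.

Theorem proposition13 (R : realType) (n m : nat) (gamma : R)
    (D : set 'rV[R[i]]_n) (rho : 'rV[R[i]]_n -> R) (p v : 'rV[R[i]]_n) (c : R)
    (hm : (1 <= m)%N) (hgamma0 : 0 <= gamma) (hgamma1 : gamma < 1)
    (hD : bounded_domain D) (hrho : Cmgamma_defining m gamma D rho)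
    (hp : boundary D p)
    (hv0 : v != 0) (hv : complex_tangent rho p v) (hc : 0 < c)
    (hflat : \forall l \near (0 : R[i]),
       rho (p + l *: v) <= - c * cmod l `^ (m%:R + gamma)) :
  (exists e0 C : R, [/\ 0 < e0, 0 < C &
     forall delta eps : R, 0 < delta -> delta < eps -> eps < e0 ->
       [/\ (ell2 D (normal_pt rho p eps) (normal_pt rho p delta)
             <= (C * ((eps - delta) * eps `^ ((m%:R + gamma)^-1 - 1)))%:E)%E,
           (eps - delta) * eps `^ ((m%:R + gamma)^-1 - 1)
             <= C * (eps `^ (m%:R + gamma)^-1 - delta `^ (m%:R + gamma)^-1)
         & eps `^ (m%:R + gamma)^-1 - delta `^ (m%:R + gamma)^-1
             <= C * ((eps - delta) * eps `^ ((m%:R + gamma)^-1 - 1))]])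
  /\
  (exists e0 C : R, [/\ 0 < e0, 0 < C &
     forall eps : R, 0 < eps -> eps < e0 ->
       (kappa2 D (normal_pt rho p eps) (inner_normal rho p)
         <= (C * eps `^ ((m%:R + gamma)^-1 - 1))%:E)%E]).
Proof.
set s := m%:R + gamma in hflat *.
have s1 : 1 <= s by rewrite ler_wpDr // ler1n.
have s0 : 0 < s by apply: lt_le_trans s1.
have th01 : 0 <= s^-1 <= 1 by rewrite invr_ge0 (ltW s0) invf_le1.
have G0 : 0 < enorm (grad rho p) by apply: enorm_gt0; case: hrho => _ _; apply.
have [r r0 region] := flat_region_in_domain hm hrho hp hflat.
split; last exact: kappa2_normal_le hc s1 G0 r0 region.
have [e0 [C [e00 C0 hC]]] := ell2_normal_le hc s1 G0 r0 region.
(* The two power estimates hold with the constants s and 1. *)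
have CS0 : 0 < C + s + 1 by lra.
exists e0, (C + s + 1); split => // delta eps d0 de ee.
set K := (eps - delta) * _.
have K0 : 0 <= K by rewrite mulr_ge0 ?powR_ge0 // subr_ge0 ltW.
have CK : 0 <= C * K by rewrite mulr_ge0 // ltW.
have sK : 0 <= s * K by rewrite mulr_ge0 // ltW.
have ge_diff := powR_diff_ge d0 de th01.
have le_diff := powR_diff_le d0 de (proj2 (andP th01)).
rewrite -/K in ge_diff le_diff.
split.
- by apply: le_trans (hC _ _ d0 de ee) _; rewrite lee_fin -/K; lra.
- rewrite -ler_pdivrMl //.
  apply: le_trans ge_diff; rewrite ler_wpM2r // lef_pV2 ?posrE //.
  by lra.
- by apply: le_trans le_diff _; lra.
Qed.
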